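(* Let $E=\bigoplus_{i\in\mathbb{Z}}\mathbb{C}e_i$ be the graded vector space with $e_i$ in degree $i$. Any simple graded pre-Lie algebra structure on $E$ whose product has the form $e_i\circ e_j=f(i)g(j)\,e_{i+j}$ for all $i,j\in\mathbb{Z}$, for some functions $f,g:\mathbb{Z}\to\mathbb{C}$, is isomorphic either to the algebra $A_a$, defined on $E$ by $$e_i\circ e_j=(1+ai)\,e_{i+j}\quad (i,j\in\mathbb{Z})$$ for some complex number $a$, or to the algebra $B_b$, defined on $E$ by $$e_i\circ e_j=\frac{i}{1+bj}\,e_{i+j}\quad (i,j\in\mathbb{Z})$$ for some complex number $b$ which is not the inverse of an integer. Moreover, all the algebras $A_a$ ($a\in\mathbb{C}$) and $B_b$ ($b\in\mathbb{C}$ not the inverse of an integer) are pairwise non-isomorphic, with the exceptions $A_a\simeq A_{-a}$ and $B_b\simeq B_{-b}$.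
   Context: All vector spaces are over $\mathbb{C}$. A pre-Lie algebra is a vector space $L$ with a bilinear product $\circ$ satisfying $(x\circ y)\circ z-x\circ(y\circ z)=(x\circ z)\circ y-x\circ(z\circ y)$ for all $x,y,z\in L$. It is graded if $L=\bigoplus_{i\in\mathbb{Z}}L_i$ with $L_i\circ L_j\subseteq L_{i+j}$. An ideal is a two-sided ideal for $\circ$; it is homogeneous if it is spanned by homogeneous elements, and non-trivial if it is different from $0$ and $L$. A graded pre-Lie algebra is called simple if its product is non-zero and it has no non-trivial homogeneous ideal. An isomorphism of pre-Lie algebras is a linear bijection preserving $\circ$; it is not required to respect the gradings. *)

(* Defs.v *)
From HB Require Import structures.
From mathcomp Require Import all_boot all_order all_algebra.
From mathcomp Require Import finmap monalg complex ring.
From mathcomp Require Import boolp classical_sets reals.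

Set Implicit Arguments.
Unset Strict Implicit.
Unset Printing Implicit Defensive.

Import Order.TTheory GRing.Theory Num.Theory.

Local Open Scope ring_scope.

Section PreLie.
Variables (K : fieldType) (L : lmodType K).
Implicit Types (op : L -> L -> L) (V : int -> set L) (I A : set L).

Definition preLie op : Prop :=
  bilinear_for *:%R *:%R op /\
  forall x y z,
    op (op x y) z - op x (op y z) = op (op x z) y - op x (op z y).

Definition subspace A : Prop :=
  A 0 /\ forall (c : K) x y, A x -> A y -> A (c *: x + y).

(* [L] is the internal direct sum of the subspaces [V i]. *)
Definition grading V : Prop :=
  [/\ forall i, subspace (V i),
      forall x, exists (s : seq int) (y : int -> L),
        (forall i, V i (y i)) /\ x = \sum_(i <- s) y i
    & forall (s : seq int) (y : int -> L), uniq s ->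
        (forall i, V i (y i)) -> \sum_(i <- s) y i = 0 ->
        forall i, i \in s -> y i = 0].

Definition graded_preLie V op : Prop :=
  [/\ grading V, preLie op
    & forall i j x y, V i x -> V j y -> V (i + j) (op x y)].

Definition ideal op I : Prop :=
  subspace I /\ forall x y, I x -> I (op x y) /\ I (op y x).

Definition span A : set L :=
  [set x | exists (n : nat) (c : 'I_n -> K) (v : 'I_n -> L),
     (forall k, A (v k)) /\ x = \sum_(k < n) c k *: v k].

Definition homogeneous V : set L := [set x | exists i, V i x].

Definition homogeneous_ideal V op I : Prop :=
  ideal op I /\
  exists A : set L, (forall x, A x -> homogeneous V x) /\ I = span A.

Definition simple_graded_preLie V op : Prop :=
  [/\ graded_preLie V op,
      exists x y, op x y <> 0
    & forall I, homogeneous_ideal V op I -> I = [set 0]%classic \/ I = setT].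

Lemma lin_scale (h : L -> L) :
  (forall k x y, h (k *: x + y) = k *: h x + h y) ->
  forall k x, h (k *: x) = k *: h x.
Proof.
move=> hl k x; have h0 : h 0 = 0.
  have := hl 1 0 0; rewrite !scale1r addr0 => /eqP.
  by rewrite -subr_eq0 opprD addNKr oppr_eq0 => /eqP.
by rewrite -[k *: x]addr0 hl h0 addr0.
Qed.

Lemma preLie_on_span op (b : int -> L) :
  (forall z k x y, op (k *: x + y) z = k *: op x z + op y z) ->
  (forall z k x y, op z (k *: x + y) = k *: op z x + op z y) ->
  (forall x, exists (s : seq int) (a : int -> K),
     x = \sum_(i <- s) a i *: b i) ->
  (forall i j k,
     op (op (b i) (b j)) (b k) - op (b i) (op (b j) (b k)) =
     op (op (b i) (b k)) (b j) - op (b i) (op (b k) (b j))) ->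
  forall x y z,
    op (op x y) z - op x (op y z) = op (op x z) y - op x (op z y).
Proof.
move=> ll lr bs bP.
pose as_ x y z := op (op x y) z - op x (op y z).
have P0l z : op 0 z = 0 by have := lin_scale (ll z) 0 0; rewrite !scale0r.
have P0r z : op z 0 = 0 by have := lin_scale (lr z) 0 0; rewrite !scale0r.
have ind (Q : L -> Prop) : Q 0 ->
    (forall k i x, Q x -> Q (k *: b i + x)) -> forall x, Q x.
  move=> Q0 QS x; have [s [a ->]] := bs x.
  by elim/big_rec: _ => // i w _; apply: QS.
move=> x y z; rewrite -/(as_ x y z) -/(as_ x z y).
have asl k u v p q : as_ (k *: u + v) p q = k *: as_ u p q + as_ v p q.
  by rewrite /as_ !ll scalerBr opprD addrACA.
have asm k u v p q : as_ p (k *: u + v) q = k *: as_ p u q + as_ p v q.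
  by rewrite /as_ !(ll, lr) scalerBr opprD addrACA.
have asr k u v p q : as_ p q (k *: u + v) = k *: as_ p q u + as_ p q v.
  by rewrite /as_ !lr scalerBr opprD addrACA.
elim/ind: x => [|k i x IHx]; first by rewrite /as_ !P0l.
rewrite !asl {}IHx; congr (_ *: _ + _).
elim/ind: y => [|l j y IHy]; first by rewrite /as_ !(P0l, P0r).
rewrite asm asr {}IHy; congr (_ *: _ + _).
elim/ind: z => [|m n z IHz]; first by rewrite /as_ !(P0l, P0r).
by rewrite asm asr {}IHz; congr (_ *: _ + _); apply: bP.
Qed.

End PreLie.

(* No gradings are involved. *)
Definition preLie_iso (K : fieldType) (L L' : lmodType K)
    (op : L -> L -> L) (op' : L' -> L' -> L') : Prop :=
  exists phi : {linear L -> L'},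
    bijective phi /\ forall x y, phi (op x y) = op' (phi x) (phi y).

(* The field of complex numbers; every [realType] is a copy of the reals. *)
Definition C (R : realType) : fieldType := R[i].

Section Examples.
Variable K : fieldType.

Definition E : lmodType K := {malg K[int]}.

Definition e (i : int) : E := << i >>.

Definition E_deg (i : int) : set E := [set x | exists c : K, x = c *: e i].

(* The bilinear product on [E] with structure constants [c]; here [x@_i] is
   the coefficient of [e i] in [x], and [msupp x] is its finite support. *)
Definition Eprod (c : int -> int -> K) (x y : E) : E :=
  \sum_(i <- msupp x) \sum_(j <- msupp y)
    (x@_i * y@_j * c i j) *: e (i + j).

Definition A_ (a : K) : E -> E -> E := Eprod (fun i j => 1 + a * i%:~R).

Definition B_ (b : K) : E -> E -> E :=
  Eprod (fun i j => i%:~R / (1 + b * j%:~R)).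

(* [n != 0] matters: [0^-1 = 0] here, while [b = 0] is an allowed parameter. *)
Definition int_inverse (b : K) : Prop :=
  exists2 n : int, n != 0 & b = (n%:~R)^-1.

Lemma EprodE c i j : Eprod c (e i) (e j) = c i j *: e (i + j).
Proof.
by rewrite /Eprod /e !msuppU oner_eq0 !big_seq_fset1 !mcoeffUU !mul1r.
Qed.

Lemma Eprod_sub c (x y : E) (dx dy : {fset int}) :
  (msupp x `<=` dx)%fset -> (msupp y `<=` dy)%fset ->
  Eprod c x y =
    \sum_(i <- dx) \sum_(j <- dy) (x@_i * y@_j * c i j) *: e (i + j).
Proof.
move=> sx sy; rewrite /Eprod.
have -> : \sum_(i <- dx) \sum_(j <- dy) (x@_i * y@_j * c i j) *: e (i + j) =
  \sum_(i <- dx) \sum_(j <- msupp y) (x@_i * y@_j * c i j) *: e (i + j).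
  apply: eq_bigr => i _; apply/esym/big_fset_incl => // j _ jy.
  by rewrite (mcoeff_outdom jy) mulr0 mul0r scale0r.
apply: big_fset_incl => // i _ ix.
by apply: big1_seq => j _; rewrite (mcoeff_outdom ix) !mul0r scale0r.
Qed.

Lemma Eprod_linl c (z : E) k x y :
  Eprod c (k *: x + y) z = k *: Eprod c x z + Eprod c y z.
Proof.
pose d := (msupp x `|` msupp y `|` msupp (k *: x + y))%fset.
have sx : (msupp x `<=` d)%fset by rewrite /d -fsetUA fsubsetUl.
have sy : (msupp y `<=` d)%fset by rewrite /d -fsetUA fsetUCA fsubsetUl.
have sxy : (msupp (k *: x + y) `<=` d)%fset by rewrite fsubsetUr.
have sz := fsubset_refl (msupp z).
rewrite (Eprod_sub c sxy sz) (Eprod_sub c sx sz) (Eprod_sub c sy sz).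
rewrite scaler_sumr -big_split; apply: eq_bigr => i _ /=.
rewrite scaler_sumr -big_split; apply: eq_bigr => j _ /=.
by rewrite mcoeffD mcoeffZ scalerA -scalerDl !mulrDl !mulrA.
Qed.

Lemma Eprod_linr c (z : E) k x y :
  Eprod c z (k *: x + y) = k *: Eprod c z x + Eprod c z y.
Proof.
pose d := (msupp x `|` msupp y `|` msupp (k *: x + y))%fset.
have sx : (msupp x `<=` d)%fset by rewrite /d -fsetUA fsubsetUl.
have sy : (msupp y `<=` d)%fset by rewrite /d -fsetUA fsetUCA fsubsetUl.
have sxy : (msupp (k *: x + y) `<=` d)%fset by rewrite fsubsetUr.
have sz := fsubset_refl (msupp z).
rewrite (Eprod_sub c sz sxy) (Eprod_sub c sz sx) (Eprod_sub c sz sy).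
rewrite scaler_sumr -big_split; apply: eq_bigr => i _ /=.
rewrite scaler_sumr -big_split; apply: eq_bigr => j _ /=.
rewrite mcoeffD mcoeffZ scalerA -scalerDl mulrDr mulrDl !mulrA.
by rewrite (mulrC (z@_i)).
Qed.

Lemma Eprod_bilinear c : bilinear_for *:%R *:%R (Eprod c).
Proof. by split=> z k x y; [apply: Eprod_linl | apply: Eprod_linr]. Qed.

Lemma E_expand (x : E) : x = \sum_(i <- msupp x) x@_i *: e i.
Proof.
rewrite {1}[x]monalgE; apply: eq_bigr => i _; apply/malgP => k.
by rewrite mcoeffZ !mcoeffU mulrnAr mulr1.
Qed.

Lemma E_grading : grading E_deg.
Proof.
split=> [i | x | s y us yE s0 i si].
- split; first by exists 0; rewrite scale0r.
  move=> c x y [p ->] [q ->]; exists (c * p + q).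
  by rewrite scalerDl scalerA.
- exists (msupp x), (fun i => x@_i *: e i); split; last exact: E_expand.
  by move=> i; exists (x@_i).
- have [c yi] := yE i; rewrite yi.
  suff -> : c = 0 by rewrite scale0r.
  have /(congr1 (mcoeff i)) := s0.
  rewrite raddf_sum mcoeff0 (bigD1_seq i) //= big1 => [|j ji].
    by rewrite addr0 yi mcoeffZ mcoeffUU mulr1.
  by have [d ->] := yE j; rewrite mcoeffZ mcoeffU (negbTE ji) mulr0.
Qed.

Lemma graded_preLie_Eprod c :
  (forall i j k,
     c i j * c (i + j) k - c j k * c i (j + k) =
     c i k * c (i + k) j - c k j * c i (k + j)) ->
  graded_preLie E_deg (Eprod c).
Proof.
move=> cP; split; first exact: E_grading.
- split; first exact: Eprod_bilinear.
  apply: (preLie_on_span (Eprod_linl c) (Eprod_linr c) (b := e)).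
    by move=> x; exists (msupp x), (fun i => x@_i); apply: E_expand.
  have Zl k (x z : E) : Eprod c (k *: x) z = k *: Eprod c x z.
    exact: (lin_scale (Eprod_linl c z)).
  have Zr k (x z : E) : Eprod c z (k *: x) = k *: Eprod c z x.
    exact: (lin_scale (Eprod_linr c z)).
  move=> i j k; rewrite !EprodE !Zl !Zr !EprodE !scalerA -!addrA (addrC k j).
  by rewrite -!scalerBl cP (addrC k j).
- move=> i j _ _ [p ->] [q ->]; exists (p * q * c i j).
  rewrite (lin_scale (Eprod_linl c _)) (lin_scale (Eprod_linr c _)) EprodE.
  by rewrite !scalerA.
Qed.

Lemma A_graded_preLie a : graded_preLie E_deg (A_ a).
Proof. by apply: graded_preLie_Eprod => i j k; rewrite !rmorphD /=; ring. Qed.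

Lemma B_graded_preLie b : ~ int_inverse b -> graded_preLie E_deg (B_ b).
Proof.
move=> bP; apply: graded_preLie_Eprod => i j k.
have nz (n : int) : 1 + b * n%:~R != 0.
  apply/eqP => h; apply: bP.
  have n0 : n%:~R != 0 :> K.
    by apply/eqP => n0; move/eqP: h; rewrite n0 mulr0 addr0 oner_eq0.
  exists (- n); first by rewrite oppr_eq0; apply: contraNneq n0 => ->.
  apply: (mulIf n0); rewrite rmorphN /= invrN mulNr mulVf //.
  by apply/eqP; rewrite -addr_eq0 addrC h.
rewrite (addrC k j); have := nz (j + k); have := nz j; have := nz k.
by rewrite !rmorphD /= => hk hj hjk; field; rewrite hk hj hjk.
Qed.

End Examples.

Arguments e {K} i.
Arguments E_deg {K} i.

(* Main.v *)
Require Import Defs.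
From HB Require Import structures.
From mathcomp Require Import all_boot all_order all_algebra.
From mathcomp Require Import finmap monalg complex ring.
From mathcomp Require Import boolp classical_sets reals.

Set Implicit Arguments.
Unset Strict Implicit.
Unset Printing Implicit Defensive.

Import Order.TTheory GRing.Theory Num.Theory.
Local Open Scope classical_set_scope.
Local Open Scope ring_scope.

(** For the classification, simplicity is used through stable sets of degrees,
and what remains is a functional equation for [f] and [g] on the integers; the
algebras obtained are told apart by left identities, left annihilators and the
eigenvalues of right multiplications.

A set [S] of degrees that is stable under non-zero products
spans a homogeneous ideal, so it is empty or everything ([simple_stable]).
On basis vectors the pre-Lie identity reads
[f i * (g j * g k * (f (i + j) - f (i + k)) -
        g (j + k) * (f j * g k - f k * g j)) = 0].
The zeros of [g] form a stable set by this relation, so [g] vanishes nowhere;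
after division the relation says, whenever [f i != 0], that
[f (i + j) - f (i + k) = g (j + k) * (f j / g j - f k / g k)].
If [f 0 != 0], taking [i = k = 0] forces [g] to be constant, and [f - f 0] is
additive: the identity [f (i + j) = f i + f j - f 0] can only fail when the
zeros of [f] form a non-empty stable set.  So [f] is affine and a rescaling
gives [A_ a].  If [f 0 = 0], then [f] is additive, and the relation becomes
[(j - k) p (j + k) = j p j - k p k] for [p = 1 / g], whose solutions are the
affine functions; a rescaling gives [B_ b], and as [p] is nowhere [0], [b] is
not the inverse of an integer.

[A_ a] has a left identity and [B_ b] has none.
An isomorphism from [A_ a] to [A_ a'] sends [e 0] to a left identity, hence to
[e 0 + t *: e s] with [s != 0]; right multiplication by such an element is
triangular with diagonal entries [1 + a' * n], and one of these entries must be
the eigenvalue [1 + a] of [e 1].  So [a] is an integer multiple of [a'], and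
conversely.
In [B_ b] the left annihilator is the line of [e 0], and right multiplication
by [e 0] has [e i] as eigenvector for [i]; an isomorphism then has to send
[e i] to a multiple of [e (m * i)] with [m] equal to [1] or [-1], and the
products of [e 1] and [e (-1)] give [b = m * b'].  The isomorphisms for opposite
parameters come from [e i |-> e (- i)]. *)

(** * Isomorphisms of pre-Lie algebras *)

Section Isomorphisms.
Variable K : fieldType.

Lemma preLie_iso_refl (L : lmodType K) (op : L -> L -> L) : preLie_iso op op.
Proof. by exists idfun; split=> //; exists idfun. Qed.

Lemma preLie_iso_sym (L L' : lmodType K) (op : L -> L -> L)
    (op' : L' -> L' -> L') : preLie_iso op op' -> preLie_iso op' op.
Proof.
case=> phi [[psi psiK phiK] phiM].
have psi_lin : linear psi by exact: can2_linear psiK phiK.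
pose psiL : {linear L' -> L} :=
  HB.pack psi (GRing.isLinear.Build K L' L *:%R psi psi_lin).
exists psiL; split; first by exists phi.
by move=> x y; apply: (can_inj psiK); rewrite phiM /= !phiK.
Qed.

Lemma preLie_iso_trans (L1 L2 L3 : lmodType K) (op1 : L1 -> L1 -> L1)
    (op2 : L2 -> L2 -> L2) (op3 : L3 -> L3 -> L3) :
  preLie_iso op1 op2 -> preLie_iso op2 op3 -> preLie_iso op1 op3.
Proof.
case=> phi [phi_bij phiM] [psi [psi_bij psiM]].
exists (psi \o phi); split; first exact: bij_comp.
by move=> x y /=; rewrite phiM psiM.
Qed.

End Isomorphisms.

(** * Products given by structure constants *)

Section Basis.
Variable K : fieldType.
Implicit Types (c : int -> int -> K) (x y : E K) (i j k n : int).

Lemma mcoeff_e i k : (e i : E K)@_k = (i == k)%:R.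
Proof. by rewrite mcoeffU. Qed.

Lemma e_neq0 i : (e i : E K) <> 0.
Proof.
move=> /(congr1 (mcoeff i)); rewrite mcoeff_e mcoeff0 eqxx => /eqP.
by rewrite oner_eq0.
Qed.

Lemma exists_mcoeff_neq0 x : x <> 0 -> exists k, x@_k != 0.
Proof.
move=> x0; apply: contrapT => /forallNP xz; apply: x0; apply/malgP => k.
by rewrite mcoeff0; apply/eqP; move/negP: (xz k); rewrite negbK.
Qed.

(** When [h i = k] has the single solution [i0], only that term of the sum
contributes to degree [k]. *)
Lemma mcoeff_sum_e x (F : int -> K) (h : int -> int) k i0 :
  (forall i, (h i == k) = (i == i0)) ->
  (\sum_(i <- msupp x) (x@_i * F i) *: e (h i) : E K)@_k = x@_i0 * F i0.
Proof.
move=> hP; rewrite raddf_sum /=.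
have termE i : ((x@_i * F i) *: e (h i) : E K)@_k =
    if i == i0 then x@_i0 * F i0 else 0.
  rewrite mcoeffZ mcoeff_e hP.
  by case: eqP => [->|_]; rewrite ?mulr1 ?mulr0.
under eq_bigr do rewrite termE.
have [xi|xi] := boolP (i0 \in msupp x).
  rewrite (bigD1_seq i0) ?fset_uniq //= eqxx big1 ?addr0 // => i /negPf -> //.
rewrite (mcoeff_outdom xi) mul0r big1_seq // => i /andP[_ ix].
by case: eqP ix xi => // -> ->.
Qed.

Lemma mcoeff_Eprod_e c x j k :
  (Eprod c x (e j))@_k = x@_(k - j) * c (k - j) j.
Proof.
rewrite /Eprod /e msuppU oner_eq0.
under eq_bigr do rewrite big_seq_fset1 mcoeffUU mulr1.
apply: (mcoeff_sum_e x (fun i => c i j) (h := fun i => i + j)) => i.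
by rewrite [in RHS]eq_sym subr_eq eq_sym.
Qed.

Lemma mcoeff_Eprod_el c i y k :
  (Eprod c (e i) y)@_k = y@_(k - i) * c i (k - i).
Proof.
rewrite /Eprod /e msuppU oner_eq0 big_seq_fset1 mcoeffUU.
under eq_bigr do rewrite mul1r.
apply: (mcoeff_sum_e y (fun j => c i j) (h := fun j => i + j)) => j.
by rewrite addrC [in RHS]eq_sym subr_eq eq_sym.
Qed.

Lemma Eprod_scalel c t x y : Eprod c (t *: x) y = t *: Eprod c x y.
Proof. exact: (lin_scale (Eprod_linl c y)). Qed.

Lemma Eprod_scaler c t x y : Eprod c x (t *: y) = t *: Eprod c x y.
Proof. exact: (lin_scale (Eprod_linr c x)). Qed.

Lemma bilinear_ext (op op' : E K -> E K -> E K) :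
  bilinear_for *:%R *:%R op -> bilinear_for *:%R *:%R op' ->
  (forall i j, op (e i) (e j) = op' (e i) (e j)) -> op = op'.
Proof.
move=> [l r] [l' r'] opP; apply/funext => x; apply/funext => y.
have ind (P : E K -> Prop) : P 0 ->
    (forall t i z, P z -> P (t *: e i + z)) -> forall z, P z.
  by move=> P0 PS z; rewrite (E_expand z); elim/big_rec: _ => // *; apply: PS.
have op0l (o : E K -> E K -> E K) : (forall z, linear (o^~ z)) ->
    forall z, o 0 z = 0.
  by move=> ol z; have := lin_scale (ol z) 0 0; rewrite !scale0r.
have op0r (o : E K -> E K -> E K) : (forall z, linear (o z)) ->
    forall z, o z 0 = 0.
  by move=> ol z; have := lin_scale (ol z) 0 0; rewrite !scale0r.
elim/ind: x => [|t i x IHx]; first by rewrite !op0l.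
have := l y t (e i) x; have := l' y t (e i) x => /= -> ->; rewrite {}IHx.
congr (_ *: _ + _); elim/ind: y => [|u j y IHy]; first by rewrite !op0r.
have := r (e i) u (e j) y; have := r' (e i) u (e j) y => /= -> ->.
by rewrite IHy opP.
Qed.

Lemma Eprod_scale_iso (s : K) c : s != 0 ->
  preLie_iso (Eprod (fun i j => s * c i j)) (Eprod c).
Proof.
move=> s0; exists (GRing.scale s : {linear E K -> E K}); split.
  exists (GRing.scale s^-1) => x /=; first by rewrite scalerK.
  by rewrite scalerA mulfV // scale1r.
move=> x y /=; rewrite Eprod_scalel Eprod_scaler; congr (_ *: _).
have -> // : Eprod (fun i j => s * c i j) = fun x y => s *: Eprod c x y.
apply: bilinear_ext; first exact: Eprod_bilinear.
  split=> z t u v;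
    by rewrite /= ?Eprod_linl ?Eprod_linr scalerDr !scalerA mulrC.
by move=> i j; rewrite !EprodE scalerA.
Qed.

(** The factor [1] puts the sum in the form used by [mcoeff_sum_e]. *)
Definition flip x : E K := \sum_(i <- msupp x) (x@_i * 1) *: e (- i).

Lemma mcoeff_flip x k : (flip x)@_k = x@_(- k).
Proof.
rewrite /flip (mcoeff_sum_e x (fun=> 1) (i0 := - k)) ?mulr1 // => i.
by rewrite eqr_oppLR.
Qed.

Lemma flip_linear : linear flip.
Proof.
by move=> t x y; apply/malgP => k; rewrite !(mcoeffD, mcoeffZ, mcoeff_flip).
Qed.

HB.instance Definition _ :=
  GRing.isLinear.Build K (E K) (E K) *:%R flip flip_linear.

Lemma flip_e i : flip (e i) = e (- i).
Proof. by apply/malgP => k; rewrite mcoeff_flip !mcoeff_e eqr_oppLR. Qed.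

Lemma flipK : involutive flip.
Proof. by move=> x; apply/malgP => k; rewrite !mcoeff_flip opprK. Qed.

Lemma Eprod_flip_iso c :
  preLie_iso (Eprod c) (Eprod (fun i j => c (- i) (- j))).
Proof.
exists flip; split; first by exists flip; apply: flipK.
suff -> : Eprod c = fun x y =>
    flip (Eprod (fun i j => c (- i) (- j)) (flip x) (flip y)).
  by move=> x y /=; rewrite flipK.
apply: bilinear_ext; first exact: Eprod_bilinear.
  by split=> z t u v; rewrite /= linearP /= ?Eprod_linl ?Eprod_linr linearP.
move=> i j; rewrite !flip_e !EprodE linearZ /= flip_e !opprK.
by rewrite opprD !opprK.
Qed.

End Basis.

(** * Classification of the simple products *)

Section Simple.
Variable K : fieldType.
Implicit Types (c : int -> int -> K) (x y : E K) (i j k n : int).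

Lemma Eprod_msupp c x y i : (Eprod c x y)@_i != 0 ->
  exists j k, [/\ x@_j != 0, y@_k != 0, c j k != 0 & i = j + k].
Proof.
move=> xyi; apply: contrapT => no; move/eqP: xyi; apply.
rewrite /Eprod raddf_sum big1_seq // => j /andP[_ jx].
rewrite raddf_sum big1_seq // => k /andP[_ ky] /=.
rewrite mcoeffZ mcoeff_e; have [jki|_] := eqVneq (j + k) i; last exact: mulr0.
have [cjk|cjk] := eqVneq (c j k) 0; first by rewrite cjk mulr0 mul0r.
by case: no; exists j, k; rewrite !mcoeff_neq0 jki.
Qed.

(** The witness ideal consists of the vectors supported in [S]: its elements
[e i] with [S i] are homogeneous and span it. *)
Lemma simple_stable c (S : int -> Prop) :
  simple_graded_preLie E_deg (Eprod c) ->
  (forall i j, S i -> c i j != 0 -> S (i + j)) ->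
  (forall i j, S i -> c j i != 0 -> S (i + j)) ->
  (forall i, ~ S i) \/ (forall i, S i).
Proof.
move=> [_ _ simp] Sl Sr.
pose I : set (E K) := [set x | forall i, x@_i != 0 -> S i].
have Isub : subspace I.
  split=> [i|t x y Ix Iy i]; first by rewrite mcoeff0 eqxx.
  rewrite mcoeffD mcoeffZ; have [->|xi _] := eqVneq x@_i 0; last exact: Ix.
  by rewrite mulr0 add0r; apply: Iy.
have Ie i : I (e i) <-> S i.
  split=> [|Si k]; first by apply; rewrite mcoeff_e eqxx oner_neq0.
  by rewrite mcoeff_e; case: (eqVneq i k) => [<- //|_]; rewrite eqxx.
have Iideal : homogeneous_ideal E_deg (Eprod c) I.
  split.
    split=> // x y Ix; split=> i /Eprod_msupp [j [k [xj yk cjk ->]]].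
      exact: Sl (Ix _ xj) cjk.
    by rewrite addrC; apply: Sr (Ix _ yk) cjk.
  exists [set x | exists2 i, S i & x = e i]; split.
    by move=> _ [i _ ->]; exists i, 1; rewrite scale1r.
  apply/seteqP; split=> [x Ix|x [n [t [v [vP ->]]]]].
    exists (size (msupp x)), (fun m => x@_(nth 0 (msupp x) m)),
      (fun m => e (nth 0 (msupp x) m)).
    split=> [m|].
      exists (nth 0 (msupp x) m) => //; apply: Ix.
      by rewrite mcoeff_neq0 mem_nth.
    by rewrite [LHS]E_expand (big_nth 0) big_mkord.
  elim/big_rec: _ => [|m y _ Iy]; first by case: Isub.
  by apply: Isub.2 => //; have [i Si ->] := vP m; apply/Ie.
case: (simp _ Iideal) => IE; [left=> i /Ie | right=> i; apply/Ie]; rewrite IE //.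
exact: e_neq0.
Qed.

Lemma Eprod_preLie_rel c : preLie (Eprod c) -> forall i j k,
  c i j * c (i + j) k - c j k * c i (j + k) =
  c i k * c (i + k) j - c k j * c i (k + j).
Proof.
move=> [_ cP] i j k; have := cP (e i) (e j) (e k).
rewrite !EprodE !Eprod_scalel !Eprod_scaler !EprodE !scalerA.
rewrite -!addrA (addrC k j) -!scalerBl => /(congr1 (mcoeff (i + (j + k)))).
by rewrite !mcoeffZ !mcoeff_e eqxx !mulr1.
Qed.

Lemma additive_int (h : int -> K) : {morph h : i j / i + j} ->
  forall i, h i = h 1 * i%:~R.
Proof.
move=> hD; have h0 : h 0 = 0.
  by have /eqP := hD 0 0; rewrite addr0 -subr_eq0 opprD addNKr oppr_eq0 => /eqP.
have hN i : h (- i) = - h i by apply/eqP; rewrite -addr_eq0 -hD addNr h0.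
have hn (n : nat) : h n%:Z = h 1 * n%:R.
  elim: n => [|n IHn]; first by rewrite h0 mulr0.
  by rewrite -[n.+1]addn1 PoszD hD IHn natrD mulrDr mulr1.
case=> n; first exact: hn.
by rewrite NegzE hN hn rmorphN mulrN.
Qed.

Variables (char0 : forall n, n%:~R = 0 :> K -> n = 0) (f g : int -> K).
Let c i j := f i * g j.
Hypothesis c_simple : simple_graded_preLie E_deg (Eprod c).

(** The pre-Lie identity on [e i], [e j], [e k], with the terms divisible by
[g j * g k] on the left. *)
Lemma preLie_rel i j k : f i * (g j * g k * (f (i + j) - f (i + k))) =
  f i * (g (j + k) * (f j * g k - f k * g j)).
Proof.
have [[_ cP _] _ _] := c_simple.
have := Eprod_preLie_rel cP i j k; rewrite /c (addrC k j).
move=> /eqP; rewrite -subr_eq0 => /eqP h.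
by apply/eqP; rewrite -subr_eq0 -h; apply/eqP; ring.
Qed.

Lemma product_nonzero : exists i j, f i != 0 /\ g j != 0.
Proof.
have [_ [x [y xy]] _] := c_simple.
have [i xyi] := exists_mcoeff_neq0 xy.
have [j [k [_ _ + _]]] := Eprod_msupp xyi.
by rewrite mulf_eq0 negb_or => /andP[]; exists j, k.
Qed.

(** The zeros of [g] are stable: if [g k = 0], the relation for some [i] with
[f i != 0] leaves [g (j + k) * f k * g j = 0]. *)
Lemma g_neq0 k : g k != 0.
Proof.
have [i [j [fi gj]]] := product_nonzero.
have [] := simple_stable (S := fun i => g i = 0) c_simple.
- move=> k' l gk; rewrite mulf_eq0 negb_or => /andP[fk gl].
  apply/eqP; apply: contraNT fk => gkl.
  have := preLie_rel i l k'; rewrite gk !(mulr0, mul0r) sub0r (addrC l) => /esym/eqP.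
  rewrite mulrN mulrN oppr_eq0 !mulf_eq0 (negPf fi) (negPf gl) (negPf gkl) /=.
  by rewrite orbF.
- by move=> k' l gk; rewrite /c gk mulr0 eqxx.
- by move=> + => /(_ k) gk; apply/eqP.
- by move=> /(_ j) gj0; rewrite gj0 eqxx in gj.
Qed.

Let u i := f i / g i.

Lemma rel_quotient i j k : f i != 0 ->
  f (i + j) - f (i + k) = g (j + k) * (u j - u k).
Proof.
move=> fi; apply: (mulfI fi); apply: (mulfI (mulf_neq0 (g_neq0 j) (g_neq0 k))).
rewrite mulrCA preLie_rel /u; field; first by rewrite !g_neq0.
Qed.

(** [rel_quotient] at [k = 0]. *)
Lemma f_step i j : f i != 0 -> f (i + j) = f i + f j - g j * u 0.
Proof.
move=> fi; have := rel_quotient j 0 fi.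
rewrite !addr0 mulrBr {1}/u mulrCA mulfV ?g_neq0 // mulr1 => /eqP.
by rewrite subr_eq => /eqP ->; rewrite addrC addrA.
Qed.

(** [f_step] gives the identity when [f i != 0], and also when
[f (- i) != 0], by applying it to [- i].  If both vanish for some [i], then [f]
only takes the values [0] and [f 0], and its zeros form a stable set. *)
Lemma sub_f0_additive : f 0 != 0 ->
  forall i j, f (i + j) = f i + f j - f 0.
Proof.
move=> f0.
have gu j : g j * u 0 = f 0.
  have /eqP := f_step j f0; rewrite add0r eq_sym addrAC -subr_eq0.
  by rewrite addrK subr_eq0 eq_sym => /eqP.
have fD i j : f i != 0 -> f (i + j) = f i + f j - f 0.
  by move=> fi; rewrite f_step // gu.
have fN i : f i = 0 -> f (- i) != 0.
  move=> fi; apply/eqP => fNi.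
  (* Translation by [i] subtracts [f 0] as long as [f] does not vanish, while
     translating back by [- i] subtracts it once more. *)
  have f_two j : f j != 0 -> f j = f 0.
    move=> fj; have fji : f (j + i) = f j - f 0 by rewrite fD // fi addr0.
    have [/eqP|fji0] := eqVneq (f (j + i)) 0.
      by rewrite fji subr_eq0 => /eqP.
    have := fD _ (- i) fji0; rewrite addrK fNi addr0 fji => /eqP.
    rewrite -subr_eq0 (_ : _ - _ = f 0 * 2%:~R); last by ring.
    by rewrite mulf_eq0 (negPf f0) => /eqP /char0.
  have [] := simple_stable (S := fun k => f k = 0) c_simple.
  - by move=> k l fk; rewrite /c fk mul0r eqxx.
  - move=> k l fk; rewrite mulf_eq0 negb_or => /andP[fl _].
    by rewrite addrC fD // fk f_two // addr0 subrr.
  - by move=> /(_ i).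
  - by move=> /(_ 0) f00; rewrite f00 eqxx in f0.
move=> i j; have [fi|] := eqVneq (f i) 0; last exact: fD.
have fNi := fN _ fi.
have := fD _ i fNi; rewrite addNr fi addr0 => h1.
have := fD _ (i + j) fNi; rewrite addKr => ->.
by rewrite (_ : f (- i) = f 0 + f 0); [ring | rewrite {1}h1 subrK].
Qed.

(** Here [f_step] at [i = 0] makes [g] constant. *)
Lemma iso_A_of_f0_neq0 : f 0 != 0 -> exists a, preLie_iso (Eprod c) (A_ a).
Proof.
move=> f0; have fD := sub_f0_additive f0.
have gE j : g j = g 0.
  have /eqP := f_step j f0; rewrite add0r eq_sym addrAC -subr_eq0.
  rewrite addrK subr_eq0 /u mulrCA -{1}[f 0]mulr1 (inj_eq (mulfI f0)).
  by rewrite eq_sym -(inj_eq (mulIf (g_neq0 0))) mulfVK ?g_neq0 // mul1r => /eqP.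
pose h i := f i - f 0.
have hD : {morph h : i j / i + j} by move=> i j; rewrite /h fD; ring.
have hE := additive_int hD.
exists (h 1 / f 0).
have -> : c = fun i j => (f 0 * g 0) * (1 + h 1 / f 0 * i%:~R).
  apply/funext => i; apply/funext => j; rewrite /c gE.
  have -> : f i = f 0 + h i by rewrite /h addrC subrK.
  by rewrite hE; field.
by apply: Eprod_scale_iso; rewrite mulf_neq0 ?g_neq0.
Qed.

(** As [f_step] and its symmetric form cover all other cases, only two zeros
[i], [j] of [f] with [f (i + j) != 0] could break additivity; then [- i] is
also a zero, and translating [i + j] by [- i] gives [f j = f (i + j)]. *)
Lemma f_additive : f 0 = 0 -> {morph f : i j / i + j}.
Proof.
move=> f0 i j.
have fD k l : f k != 0 -> f (k + l) = f k + f l.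
  by move=> fk; rewrite f_step // /u f0 mul0r mulr0 subr0.
have [fi|] := eqVneq (f i) 0; last exact: fD.
have [fNi|fNi] := eqVneq (f (- i)) 0; last first.
  by have := fD _ i fNi; rewrite addNr f0 fi addr0 => h; rewrite -h eqxx in fNi.
have [fj|] := eqVneq (f j) 0; last by move=> fj; rewrite [i + j]addrC fD // addrC.
rewrite fi fj addr0; apply/eqP; apply: contraT => fij.
have := fD _ (- i) fij; rewrite addrAC subrr add0r fj fNi addr0 => fij0.
by rewrite fij0 eqxx in fij.
Qed.

(** Affine functions solve the equation, so it suffices that a solution [q]
vanishing at [0] and [1] is zero.  It vanishes at [-1] by [(j, k) = (-1, 1)]; then
[k = -1] propagates zeros upwards and [k = 1] downwards. *)
Lemma affine_int (p : int -> K) :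
  (forall j k, (j - k)%:~R * p (j + k) = j%:~R * p j - k%:~R * p k) ->
  forall n, p n = p 0 + (p 1 - p 0) * n%:~R.
Proof.
move=> pP; pose q n := p n - p 0 - (p 1 - p 0) * n%:~R.
have qP j k : (j - k)%:~R * q (j + k) = j%:~R * q j - k%:~R * q k.
  have := pP j k; rewrite /q !rmorphB !rmorphD /= => h.
  by rewrite !mulrBr h; ring.
have cancel0 n z : n != 0 -> n%:~R * z = 0 :> K -> z = 0.
  move=> n0 /eqP; rewrite mulf_eq0 => /orP[/eqP/char0/eqP|/eqP //].
  by rewrite (negPf n0).
have q0 : q 0 = 0 by rewrite /q; ring.
have q1 : q 1 = 0 by rewrite /q; ring.
have qN1 : q (- 1) = 0.
  have := qP (- 1) 1; rewrite addNr q0 q1 !mulr0 subr0.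
  by move=> /esym/(@cancel0 (-1)); apply.
suff qz : forall n, q n = 0.
  by move=> n; have /eqP := qz n; rewrite /q -addrA -opprD subr_eq0 => /eqP.
have qn (m : nat) : q m.+1%:Z = 0.
  elim: m => // m IH; have := qP m.+2%:Z (- 1).
  rewrite qN1 mulr0 subr0 (_ : m.+2%:Z - 1 = m.+1%:Z) ?IH ?mulr0; last first.
    by rewrite -[m.+2]addn1 PoszD addrK.
  by move=> /esym/cancel0; apply.
have qm (m : nat) : q (- m.+1%:Z) = 0.
  elim: m => // m IH; have := qP (- m.+2%:Z) 1.
  rewrite q1 mulr0 subr0 (_ : - m.+2%:Z + 1 = - m.+1%:Z) ?IH ?mulr0; last first.
    by rewrite -[m.+2]addn1 PoszD opprD addrNK.
  by move=> /esym/cancel0; apply.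
by case=> [[//|m]|m]; rewrite ?NegzE.
Qed.

(** [rel_quotient] at [i = 1] is the equation of [affine_int] for [1 / g]. *)
Lemma iso_B_of_f0_eq0 : f 0 = 0 ->
  exists2 b, ~ int_inverse b & preLie_iso (Eprod c) (B_ b).
Proof.
move=> f0; have fD := f_additive f0; have fE := additive_int fD.
have f1 : f 1 != 0.
  have [i [_ [fi _]]] := product_nonzero.
  by apply: contraNneq fi => f1; rewrite fE f1 mul0r.
pose p n := (g n)^-1.
have pE : forall n, p n = p 0 + (p 1 - p 0) * n%:~R.
  apply: affine_int => j k; have := rel_quotient j k f1.
  rewrite /u fE (fE (1 + k)) (fE j) (fE k) => h.
  apply: (mulfI f1); apply: (mulfI (g_neq0 (j + k))).
  have e1 : g (j + k) * (f 1 * ((j - k)%:~R * p (j + k))) = f 1 * (j - k)%:~R.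
    by rewrite /p; field; rewrite g_neq0.
  rewrite e1 [RHS](_ : _ = g (j + k) * (f 1 * j%:~R / g j - f 1 * k%:~R / g k)).
    by rewrite -h !rmorphB !rmorphD /=; ring.
  by rewrite /p; ring.
have p0 : p 0 != 0 by rewrite invr_eq0 g_neq0.
pose b := (p 1 - p 0) / p 0.
have gE n : g n = g 0 / (1 + b * n%:~R).
  apply: invr_inj; rewrite invf_div -/(p n) pE /b -[(g 0)^-1]/(p 0); field.
  by [].
have bnz n : 1 + b * n%:~R != 0.
  by apply: contraNneq (g_neq0 n) => h; rewrite gE h invr0 mulr0.
exists b.
  case=> n n0 bn; have := bnz (- n); rewrite bn rmorphN /= mulrN.
  rewrite mulVf ?subrr ?eqxx //.
  by apply: contra_neq n0 => /char0.
have -> : c = fun i j => (f 1 * g 0) * (i%:~R / (1 + b * j%:~R)).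
  by apply/funext => i; apply/funext => j; rewrite /c fE gE; ring.
by apply: Eprod_scale_iso; rewrite mulf_neq0 ?g_neq0.
Qed.

End Simple.

(** * The algebras A and B up to isomorphism *)

Section Distinction.
Variable K : fieldType.
Variables (char0 : forall n : int, n%:~R = 0 :> K -> n = 0).
Implicit Types (a b : K) (x y : E K) (i j k n s : int).

Lemma int_mul_eq1 m n : m * n = 1 -> m = n /\ (m = 1 \/ m = - 1).
Proof.
move=> mn; have /eqP := congr1 absz mn; rewrite abszM muln_eq1.
case: m mn => [m|m] mn /andP[/eqP m1 _]; rewrite /= in m1.
  by move: mn; rewrite m1 mul1r => ->; split=> //; left.
case: m1 mn => ->; rewrite NegzE mulN1r => mn; rewrite -[n]opprK mn.
by split=> //; right.
Qed.

Lemma int_unit_of_field m n : m%:~R * n%:~R = 1 :> K -> m * n = 1.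
Proof.
move=> mn; apply/eqP; rewrite -subr_eq0; apply/eqP/char0.
by rewrite rmorphB rmorphM /= mn subrr.
Qed.

Lemma A_flip_iso a : preLie_iso (A_ a) (A_ (- a)).
Proof.
have := Eprod_flip_iso (fun i j => 1 + a * i%:~R).
rewrite /A_; congr (preLie_iso _ (Eprod _)).
by apply/funext => i; apply/funext => j; rewrite rmorphN mulrN mulNr.
Qed.

Lemma B_flip_iso b : preLie_iso (B_ b) (B_ (- b)).
Proof.
apply: preLie_iso_trans (Eprod_flip_iso _) _.
have -> : (fun i j => (- i)%:~R / (1 + b * (- j)%:~R)) =
    fun i j => -1 * (i%:~R / (1 + - b * j%:~R)).
  apply/funext => i; apply/funext => j.
  by rewrite !rmorphN /= mulrN !mulNr mul1r.
by apply: Eprod_scale_iso; rewrite oppr_eq0 oner_eq0.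
Qed.

Lemma A_left_id a y : A_ a (e 0) y = y.
Proof.
apply/malgP => k; rewrite mcoeff_Eprod_el subr0 mulr0.
by rewrite addr0 mulr1.
Qed.

Lemma A_not_iso_B a b : ~ preLie_iso (A_ a) (B_ b).
Proof.
move=> [phi [[psi _ psiK] phiM]].
have := phiM (e 0) (psi (e 0)).
rewrite A_left_id psiK => /(congr1 (mcoeff 0)).
rewrite mcoeff_Eprod_e mcoeff_e eqxx subrr mul0r mulr0 => /eqP.
by rewrite oner_eq0.
Qed.

(** The coefficients of [x] satisfy [x_k * (1 + a * k) = (k == 0)], so apart
from [0] only the root [s] of [1 + a * s], if there is one, can lie in the
support. *)
Lemma A_left_id_shape a x : A_ a x (e 0) = e 0 ->
  exists s t, s != 0 /\ x = e 0 + t *: e s.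
Proof.
move=> xP; have xE k : x@_k * (1 + a * k%:~R) = (0 == k)%:R.
  by rewrite -mcoeff_e -[in RHS]xP mcoeff_Eprod_e subr0.
have coefE k : 1 + a * k%:~R != 0 -> x@_k = (0 == k)%:R.
  move=> ak; apply: (mulIf ak); rewrite xE.
  by case: eqP => [<-|_]; rewrite ?mul0r // mulr0 addr0 mulr1.
have [[s sP]|no] := pselect (exists s, 1 + a * s%:~R = 0); last first.
  (* Any non-zero [s] will do here, as its coefficient is [0]. *)
  exists 1, 0; split=> //; apply/malgP => k.
  rewrite scale0r addr0 mcoeff_e coefE //.
  by apply/eqP => ak; apply: no; exists k.
have s0 : s != 0.
  by apply/eqP => s0; move/eqP: sP; rewrite s0 mulr0 addr0 oner_eq0.
exists s, x@_s; split=> //; apply/malgP => k.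
rewrite mcoeffD mcoeffZ !mcoeff_e; have [<-|sk] := eqVneq s k.
  by rewrite eq_sym (negPf s0) add0r mulr1.
rewrite mulr0 addr0 coefE //; apply: contra_neq sk => kP.
apply/eqP; rewrite -subr_eq0; apply/eqP/char0.
have : a * (s - k)%:~R = 0.
  transitivity ((1 + a * s%:~R) - (1 + a * k%:~R)); last by rewrite sP kP subrr.
  by rewrite rmorphB /=; ring.
move=> /eqP; rewrite mulf_eq0 => /orP[/eqP a0|/eqP //].
by move/eqP: sP; rewrite a0 mul0r addr0 oner_eq0.
Qed.

(** Otherwise the support would contain [i], [i - s], [i - 2 s], and so on. *)
Lemma exists_extreme s y : s != 0 -> y <> 0 ->
  exists i, y@_i != 0 /\ y@_(i - s) = 0.
Proof.
move=> s0 y0; apply: contrapT => no.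
have yS i : y@_i != 0 -> y@_(i - s) != 0.
  by move=> yi; apply/eqP => yis; apply: no; exists i.
have [i yi] := exists_mcoeff_neq0 y0.
pose w (m : nat) := i - s * m%:Z.
have yw m : w m \in msupp y.
  rewrite -mcoeff_neq0; elim: m => [|m IHm]; first by rewrite /w mulr0 subr0.
  suff -> : w m.+1 = w m - s by apply: yS.
  by rewrite /w -addn1 PoszD mulrDr mulr1 opprD addrA.
have w_inj : injective w.
  by move=> m n /addrI/oppr_inj/(mulfI s0) [].
have : (size (map w (iota 0 (size (msupp y)).+1)) <= size (msupp y))%N.
  apply: uniq_leq_size; first by rewrite map_inj_uniq ?iota_uniq.
  by move=> _ /mapP[m _ ->].
by rewrite size_map size_iota ltnn.
Qed.

(** At an extreme degree [i] of an eigenvector only the [e 0] part of the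
multiplier contributes, and it acts on [e i] as [1 + a * i]. *)
Lemma A_right_eigenvalue a s t l y : s != 0 -> y <> 0 ->
  A_ a y (e 0 + t *: e s) = l *: y -> exists n, l = 1 + a * n%:~R.
Proof.
move=> s0 y0 eig; have [i [yi yis]] := exists_extreme s0 y0; exists i.
have /(congr1 (mcoeff i)) := eig.
rewrite [e 0 + _]addrC /A_ Eprod_linr mcoeffD !mcoeffZ !mcoeff_Eprod_e yis.
by rewrite mul0r mulr0 add0r subr0 mulrC => /(mulIf yi).
Qed.

(** In [A_ a], [e 1] is an eigenvector of right multiplication by [e 0] for
[1 + a]; its image is one for right multiplication by the image of [e 0]. *)
Lemma A_iso_multiple a a' : preLie_iso (A_ a) (A_ a') ->
  exists m : int, a = a' * m%:~R.
Proof.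
move=> [phi [[psi phiK psiK] phiM]].
have idP : A_ a' (phi (e 0)) (e 0) = e 0.
  by rewrite -[e 0 in X in A_ _ _ X]psiK -phiM A_left_id psiK.
have [s [t [s0 phi0]]] := A_left_id_shape idP.
have phi1 : phi (e 1) <> 0.
  by rewrite -(linear0 phi) => /(can_inj phiK); apply: e_neq0.
have eig : A_ a' (phi (e 1)) (e 0 + t *: e s) = (1 + a) *: phi (e 1).
  by rewrite -phi0 -phiM /A_ EprodE addr0 mulr1 linearZ.
have [n an] := A_right_eigenvalue s0 phi1 eig.
by exists n; apply: (addrI 1).
Qed.

Lemma A_iso_eq a a' : preLie_iso (A_ a) (A_ a') -> a' = a \/ a' = - a.
Proof.
move=> iso; have [m am] := A_iso_multiple iso.
have [m' am'] := A_iso_multiple (preLie_iso_sym iso).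
have [a0|a0] := eqVneq a 0; first by left; rewrite am' a0 mul0r.
have /int_unit_of_field/int_mul_eq1 [_ m'E] : m'%:~R * m%:~R = 1 :> K.
  by apply: (mulfI a0); rewrite mulrA -am' -am mulr1.
rewrite am'; case: m'E => ->; [left|right]; first by rewrite mulr1.
by rewrite rmorphN mulrN mulr1.
Qed.

Lemma B_denominator_neq0 b n : ~ int_inverse b -> 1 + b * n%:~R != 0.
Proof.
move=> bP; apply/eqP => h; apply: bP.
have n0 : n%:~R != 0 :> K.
  by apply/eqP => n0; move/eqP: h; rewrite n0 mulr0 addr0 oner_eq0.
exists (- n); first by rewrite oppr_eq0; apply: contraNneq n0 => ->.
apply: (mulIf n0); rewrite rmorphN /= invrN mulNr mulVf //.
by apply/eqP; rewrite -addr_eq0 addrC h.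
Qed.

Lemma mcoeff_B_e0 b x k : (B_ b x (e 0))@_k = x@_k * k%:~R.
Proof. by rewrite mcoeff_Eprod_e subr0 mulr0 addr0 divr1. Qed.

(** The image of [e 0] is a left annihilator, hence [c *: e 0].  Comparing right
multiplications by [e 0] and by [c *: e 0], the image of [e i] is supported where
[c * k = i].  For [i = 1] this makes [c] the inverse of an integer, and the same
comparison on the preimage of [e 1] makes [c] an integer. *)
Lemma B_iso_monomial b b' (phi : {linear E K -> E K}) : bijective phi ->
  (forall x y, phi (B_ b x y) = B_ b' (phi x) (phi y)) ->
  exists m : int, (m = 1 \/ m = - 1) /\
    exists2 l : int -> K, l 0 = m%:~R & forall i, phi (e i) = l i *: e (m * i).
Proof.
move=> [psi phiK psiK] phiM.
have [c phi0] : exists c, phi (e 0) = c *: e 0.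
  exists (phi (e 0))@_0; apply/malgP => k; rewrite mcoeffZ mcoeff_e.
  have [<-|k0] := eqVneq 0 k; first by rewrite mulr1.
  have := phiM (e 0) (psi (e 0)).
  have -> : B_ b (e 0) (psi (e 0)) = 0.
    by apply/malgP => j; rewrite mcoeff_Eprod_el mul0r mulr0 mcoeff0.
  rewrite linear0 psiK => /(congr1 (mcoeff k)); rewrite mcoeff_B_e0 mcoeff0.
  move=> /esym/eqP; rewrite mulf_eq0 mulr0 => /orP[/eqP //|/eqP/char0 k00].
  by rewrite k00 in k0.
have supp i k : (phi (e i))@_k != 0 -> c * k%:~R = i%:~R.
  move=> phik; apply: (mulfI phik); have := phiM (e i) (e 0).
  rewrite phi0 /B_ Eprod_scaler EprodE addr0 mulr0 addr0 divr1 linearZ /=.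
  move=> /(congr1 (mcoeff k)); rewrite !mcoeffZ mcoeff_B_e0 => h.
  by rewrite [RHS]mulrC h; ring.
have [k phik] : exists k, (phi (e 1))@_k != 0.
  by apply: exists_mcoeff_neq0; rewrite -(linear0 phi) => /(can_inj phiK); apply: e_neq0.
have ck := supp _ _ phik.
have [m cm] : exists m : int, c = m%:~R.
  have [m psim] : exists m, (psi (e 1))@_m != 0.
    apply: exists_mcoeff_neq0 => psi1; apply: (@e_neq0 K 1).
    by rewrite -[LHS]psiK psi1 linear0.
  exists m; apply: (mulfI psim).
  suff /(congr1 (mcoeff m)) : B_ b (psi (e 1)) (e 0) = c *: psi (e 1).
    by rewrite mcoeff_B_e0 mcoeffZ => ->; rewrite mulrC.
  apply: (can_inj phiK); rewrite phiM linearZ /= psiK phi0 /B_ Eprod_scaler EprodE.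
  by rewrite addr0 mulr0 addr0 divr1 scale1r.
have [mk m1] : m = k /\ (m = 1 \/ m = -1).
  by apply: int_mul_eq1; apply: int_unit_of_field; rewrite -cm.
have mm : m * m = 1 by case: m1 => ->.
exists m; split=> //; exists (fun i => (phi (e i))@_(m * i)).
  by rewrite mulr0 phi0 mcoeffZ mcoeff_e eqxx mulr1.
move=> i; apply/malgP => n; rewrite mcoeffZ mcoeff_e.
have [<-|nmi] := eqVneq (m * i) n; first by rewrite mulr1.
rewrite mulr0; apply/eqP; apply: contraNT nmi => /supp.
rewrite cm -rmorphM => h; rewrite -[n]mul1r -mm -mulrA; apply/eqP; congr (_ * _).
apply/eqP; rewrite eq_sym -subr_eq0; apply/eqP/char0.
by rewrite rmorphB /= h subrr.
Qed.

(** With [t = l 1 * l (- 1)], the products [e 1 o e (- 1)] and [e (- 1) o e 1]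
give [1 - m * b' = t * (1 - b)] and [1 + m * b' = t * (1 + b)]; the sum of the
two gives [t = 1]. *)
Lemma B_iso_eq b b' : ~ int_inverse b -> ~ int_inverse b' ->
  preLie_iso (B_ b) (B_ b') -> b' = b \/ b' = - b.
Proof.
move=> bP b'P [phi [phi_bij phiM]].
have [m [m1 [l l0 phiE]]] := B_iso_monomial phi_bij phiM.
have d := @B_denominator_neq0 b ^~ bP; have d' := @B_denominator_neq0 b' ^~ b'P.
have m0 : m%:~R != 0 :> K.
  by case: m1 => ->; rewrite ?rmorphN ?oppr_eq0 oner_eq0.
have lE i : i != 0 ->
    1 + b' * (m * - i)%:~R = l i * l (- i) * (1 + b * (- i)%:~R).
  move=> i0; have i0' : i%:~R != 0 :> K by apply: contra_neq i0 => /char0.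
  have := phiM (e i) (e (- i)); rewrite !phiE /B_ Eprod_scalel Eprod_scaler !EprodE.
  rewrite linearZ /= phiE -mulrDr subrr l0 !scalerA.
  move=> /(congr1 (mcoeff (m * 0))).
  rewrite !mcoeffZ mcoeff_e eqxx !mulr1 [(m * i)%:~R]rmorphM /= => h.
  have := d (- i); have := d' (m * - i).
  move: (1 + b' * _) (1 + b * _) h => D' D h D'0 D0.
  apply: (mulfI i0'); apply: (mulfI m0); apply: (mulIf (invr_neq0 D'0)).
  apply: (mulIf (invr_neq0 D0)); transitivity (i%:~R / D * m%:~R).
    by field; rewrite D0 D'0.
  by rewrite h; field; rewrite D0 D'0.
pose t := l 1 * l (- 1).
have hN : 1 - b' * m%:~R = t * (1 - b).
  by have := lE 1 isT; rewrite !rmorphM !rmorphN /= !mulrN !mulr1.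
have hP : 1 + b' * m%:~R = t * (1 + b).
  have := lE (- 1) isT; rewrite opprK mulr1 mulr1 => ->.
  by rewrite /t [l 1 * _]mulrC.
have t1 : t = 1.
  apply/eqP; rewrite -subr_eq0; apply/eqP.
  have h2 : 2%:~R * (t - 1) = 0 :> K.
    transitivity (t * (1 + b) + t * (1 - b) - 2%:~R); first by ring.
    by rewrite -hP -hN; ring.
  by move/eqP: h2; rewrite mulf_eq0 => /orP[/eqP/char0|/eqP].
move: hP; rewrite t1 mul1r => /addrI; case: m1 => -> bb'; [left|right].
  by rewrite -bb' mulr1.
by rewrite -bb' rmorphN mulrN mulr1 opprK.
Qed.

End Distinction.

Theorem theorem0p1 (R : realType) :
  (forall (op : E (C R) -> E (C R) -> E (C R)) (f g : int -> C R),
     simple_graded_preLie E_deg op ->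
     (forall i j : int, op (e i) (e j) = (f i * g j) *: e (i + j)) ->
     (exists a : C R, preLie_iso op (A_ a)) \/
     (exists2 b : C R, ~ int_inverse b & preLie_iso op (B_ b))) /\
  [/\ forall a a' : C R,
        preLie_iso (A_ a) (A_ a') <-> a' = a \/ a' = - a,
      forall b b' : C R, ~ int_inverse b -> ~ int_inverse b' ->
        (preLie_iso (B_ b) (B_ b') <-> b' = b \/ b' = - b)
    & forall a b : C R, ~ int_inverse b -> ~ preLie_iso (A_ a) (B_ b)].
Proof.
have char0 (n : int) : n%:~R = 0 :> C R -> n = 0.
  by move=> /eqP; rewrite (@intr_eq0 R[i]) => /eqP.
split=> [op f g op_simple opE|].
  have opF : op = Eprod (fun i j => f i * g j).
    apply: bilinear_ext; [|exact: Eprod_bilinear|].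
      by case: op_simple => [[_ []]].
    by move=> i j; rewrite EprodE.
  rewrite opF in op_simple *; have [f0|f0] := eqVneq (f 0) 0.
    by right; apply: iso_B_of_f0_eq0.
  by left; apply: iso_A_of_f0_neq0.
split=> [a a'|b b' bP b'P|a b _]; last exact: A_not_iso_B.
  split=> [|[] ->]; first exact: A_iso_eq.
    exact: preLie_iso_refl.
  exact: A_flip_iso.
split=> [|[] ->]; first exact: B_iso_eq.
  exact: preLie_iso_refl.
exact: B_flip_iso.
Qed.
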